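(* Let $G$ be a graph on $n$ vertices and let $k\geq 1$. Then $\operatorname{ppt}_k(G)=n-1$ if and only if $G=K_1$ or $G=K_2$.
   Context: All graphs are finite and simple, and are not assumed to be connected; equality of graphs means isomorphism. $K_n$ is the complete graph on $n$ vertices. For a graph $G$ and $S\subseteq V(G)$, let $N(v)$ be the set of neighbors of $v$ and $N[S]=S\cup\bigcup_{s\in S}N(s)$. Define $S^{[0]}=S$, $S^{[1]}=N[S]$, and for $t\geq 1$, $S^{[t+1]}=S^{[t]}\cup\{w\in V(G) : \exists\, v\in S^{[t]},\ w\in N(v)\setminus S^{[t]} \text{ and } |N(v)\setminus S^{[t]}|\leq k\}$. The set $S$ is a $k$-power dominating set of $G$ if $S^{[\ell]}=V(G)$ for some $\ell$; a minimum $k$-power dominating set is one of minimum cardinality. For a $k$-power dominating set $S$, $\operatorname{ppt}_k(G,S)$ is the smallest $\ell\geq 0$ with $S^{[\ell]}=V(G)$. The $k$-power propagation time of $G$ is $\operatorname{ppt}_k(G)=\min\{\operatorname{ppt}_k(G,S) : S \text{ is a minimum } k\text{-power dominating set of } G\}$. *)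

(* Defs.v *)
From mathcomp Require Import all_boot.
From mathcomp Require Import boolp.

Set Implicit Arguments.
Unset Strict Implicit.
Unset Printing Implicit Defensive.

Record sgraph := SGraph {
  vertex :> finType;
  adj : rel vertex;
  adj_sym : symmetric adj;
  adj_irr : irreflexive adj
}.

Definition isomorphic (G H : sgraph) : Prop :=
  exists2 f : G -> H, bijective f & forall x y, adj (f x) (f y) = adj x y.

Section Complete.
Variable n : nat.

Definition complete_adj : rel 'I_n := fun i j => i != j.

Lemma complete_sym : symmetric complete_adj.
Proof. by move=> i j; rewrite /complete_adj eq_sym. Qed.

Lemma complete_irr : irreflexive complete_adj.
Proof. by move=> i; rewrite /complete_adj eqxx. Qed.

Definition complete : sgraph := SGraph complete_sym complete_irr.
End Complete.

Section PowerDomination.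
Variables (k : nat) (G : sgraph).
Implicit Types (v w : G) (S X : {set G}).

Definition nbr v : {set G} := [set w | adj v w].

Definition closed_nbr S : {set G} := S :|: \bigcup_(s in S) nbr s.

Definition force X : {set G} :=
  X :|: [set w | [exists v in X, (w \in nbr v :\: X) && (#|nbr v :\: X| <= k)]].

(* [observed S t] is S^{[t]}: the passage from t = 0 to t = 1 is the
   domination step, all later ones are forcing steps. *)
Definition observed S (t : nat) : {set G} :=
  if t is t'.+1 then iter t' force (closed_nbr S) else S.

Definition power_dominating S : Prop :=
  exists l, observed S l == [set: G].

Definition minimum_power_dominating S : Prop :=
  power_dominating S /\
  forall S', power_dominating S' -> #|S| <= #|S'|.

Definition ppt_of S (hS : power_dominating S) : nat := ex_minn hS.

Definition ppt_value (l : nat) : Prop :=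
  exists S (hS : minimum_power_dominating S), ppt_of (proj1 hS) = l.

Lemma power_dominating_setT : power_dominating [set: G].
Proof. by exists 0. Qed.

Lemma minimum_power_dominating_ex : exists S, minimum_power_dominating S.
Proof.
have exn : exists n, `[< exists2 S, power_dominating S & #|S| = n >].
  by exists #|[set: G]|; apply/asboolP; exists [set: G] => //;
    exact: power_dominating_setT.
case: (ex_minnP exn) => n /asboolP[S hS cS] minn.
exists S; split=> // S' hS'; rewrite cS; apply: minn.
by apply/asboolP; exists S'.
Qed.

Lemma ppt_value_ex : exists l, `[< ppt_value l >].
Proof.
have [S hS] := minimum_power_dominating_ex.
by exists (ppt_of (proj1 hS)); apply/asboolP; exists S, hS.
Qed.

Definition ppt : nat := ex_minn ppt_value_ex.

End PowerDomination.

(* Main.v *)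
Require Import Defs.
From mathcomp Require Import all_boot all_order all_algebra.
From mathcomp Require Import zify.

(** Until all of [G] is observed, every round observes at least one new vertex.
    Hence a propagation time of [n - 1] leaves no slack: the minimum set is a
    single vertex [v], and each round observes exactly one vertex
    ([observed_growth]).  If there is a first round, [v] is therefore a leaf,
    with a unique neighbour [w].

    If there is a second round, only [w] can force in it, and then it observes
    all its neighbours.  Starting from [w] instead of [v] reaches the same set
    one round earlier, and stays one round ahead for ever after
    ([observed_leaf_shift]).  As [[set w]] is also of minimum cardinality, the
    propagation time would be at most [n - 2], a contradiction.  So there is at
    most one round: with none, [G] is the single vertex [v], and with one it is
    the edge [vw]. *)

Set Implicit Arguments.
Unset Strict Implicit.
Unset Printing Implicit Defensive.

Section Complete.
Variable G : sgraph.

Lemma isomorphic_complete n : #|G| = n ->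
  (forall x y : G, adj x y = (x != y)) -> isomorphic G (complete n).
Proof.
move=> <- adjE; exists enum_rank; first exact: enum_rank_bij.
by move=> x y; rewrite adjE /= /complete_adj (inj_eq enum_rank_inj).
Qed.

Lemma complete_isomorphic n : isomorphic G (complete n) ->
  #|G| = n /\ (forall x y : G, adj x y = (x != y)).
Proof.
case=> f f_bij f_adj; split.
  by rewrite (bij_eq_card f_bij) card_ord.
by move=> x y; rewrite -f_adj /= /complete_adj (inj_eq (bij_inj f_bij)).
Qed.

End Complete.

Section Propagation.
Variables (k : nat) (G : sgraph).
Implicit Types (v w : G) (S X : {set G}) (t u l : nat).

Lemma in_nbr v w : (w \in nbr v) = adj v w.
Proof. by rewrite inE. Qed.

Lemma nbr_closed_nbr S v : v \in S -> nbr v \subset closed_nbr S.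
Proof. by move=> vS; rewrite subsetU // bigcup_sup ?orbT. Qed.

Lemma closed_nbr1 v : closed_nbr [set v] = v |: nbr v.
Proof. by rewrite /closed_nbr big_set1. Qed.

Lemma force_closed X : (forall v, v \in X -> nbr v \subset X) -> force k X = X.
Proof.
move=> clX; apply/setUidPl/subsetP=> w.
rewrite inE => /exists_inP[v vX /andP[/setDP[w_v w_nX] _]].
by rewrite (subsetP (clX v vX)) in w_nX.
Qed.

Lemma sub_observedS S t : observed k S t \subset observed k S t.+1.
Proof. by case: t => [|t]; apply: subsetUl. Qed.

(** The first round follows another rule than the later ones; but a set that
    the domination step does not enlarge has no outside neighbours, and so is
    not enlarged by forcing either. *)
Lemma observed_stable S t : observed k S t.+1 = observed k S t ->
  forall u, t <= u -> observed k S u = observed k S t.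
Proof.
move=> stab u /subnK <-; elim: (u - t) => // d IHd; rewrite addSn.
case: t stab {u} IHd => [|t] stab.
  rewrite addn0; case: d => [//|d] /= IHd; rewrite IHd.
  apply: force_closed => v vS.
  by rewrite -[S]stab; apply: nbr_closed_nbr.
by rewrite addnS => /= ->.
Qed.

Lemma observed_set0 t : observed k (set0 : {set G}) t = set0.
Proof.
apply: (@observed_stable _ 0) => //.
by rewrite /= /closed_nbr big_set0 setU0.
Qed.

(** At least one vertex is observed in each of the [l - t] rounds that remain
    before completion, since a round without effect would freeze the process
    short of [setT]. *)
Lemma observed_growth S l :
  observed k S l = setT -> (forall t, observed k S t = setT -> l <= t) ->
  forall t, t <= l -> #|observed k S t| + (l - t) <= #|G|.
Proof.
move=> obs_l min_l t /subKn <-; elim: (l - t) (leq_subr t l) => [|d IHd] d_le.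
  by rewrite subn0 subnn addn0 max_card.
have lt_dl : l - d.+1 < l by rewrite ltn_subrL (leq_trans _ d_le).
have: observed k S (l - d.+1) \proper observed k S (l - d.+1).+1.
  rewrite properEneq sub_observedS andbT eq_sym; apply/eqP => stab.
  have := min_l _ (etrans (esym (observed_stable stab (ltnW lt_dl))) obs_l).
  by rewrite leqNgt lt_dl.
move/proper_card; have := IHd (ltnW d_le).
by rewrite subnSK //; lia.
Qed.

(** All neighbours of [v] are observed after the first round, so that any
    forcing in the second one comes from [w].  As something is forced, [w] has
    at most [k] unobserved neighbours, and all of them get observed: the second
    round from [v] completes the closed neighbourhood of [w], which is the first
    round from [w].  From then on both processes run under the forcing rule. *)
Lemma observed_leaf_shift v w : nbr v = [set w] ->
    observed k [set v] 2 != observed k [set v] 1 ->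
  forall t, observed k [set w] t.+1 = observed k [set v] t.+2.
Proof.
move=> nbr_v; set X := closed_nbr [set v].
have XE : X = [set v; w] by rewrite /X closed_nbr1 nbr_v.
have v_nbr_w : v \in nbr w by rewrite in_nbr adj_sym -in_nbr nbr_v set11.
have forcing x z : x \in X -> z \in nbr x -> z \notin X -> x = w.
  rewrite XE => /set2P[->|//]; rewrite nbr_v => /set1P ->.
  by rewrite set22.
move=> /= neqX.
suff step1 : closed_nbr [set w] = force k X.
  by elim=> [//|t /= ->].
(* Otherwise [w], the only candidate, could not force, and the round from [v]
   would observe nothing new. *)
have few : #|nbr w :\: X| <= k.
  rewrite leqNgt; apply: contra neqX => many.
  apply/eqP/setUidPl/subsetP => z; rewrite inE.
  case/exists_inP=> x xX /andP[/setDP[z_x zX]].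
  by rewrite (forcing x z) // leqNgt many.
rewrite closed_nbr1; apply/setP=> z; rewrite [in RHS]inE.
case zX: (z \in X) => /=.
  by move: zX; rewrite XE => /set2P[]->; rewrite ?setU11 // setU1r.
have z_neq_w : z != w by apply: contraFneq zX => ->; rewrite XE set22.
rewrite in_setU1 (negbTE z_neq_w) inE /=.
apply/idP/exists_inP => [z_w | [x xX /andP[/setDP[z_x z_nX] _]]].
  by exists w; [rewrite XE set22 | rewrite in_setD zX z_w few].
by rewrite -(forcing x z).
Qed.

Lemma ppt_le S t :
  minimum_power_dominating k S -> observed k S t = setT -> ppt k G <= t.
Proof.
move=> minS obs_t; rewrite /ppt; case: ex_minnP => m _ min_m.
apply: (@leq_trans (ppt_of (proj1 minS))).
  by apply: min_m; apply/boolp.asboolP; exists S, minS.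
by rewrite /ppt_of; case: ex_minnP => l _; apply; apply/eqP.
Qed.

Lemma ppt_attained : exists S,
  [/\ minimum_power_dominating k S, observed k S (ppt k G) = setT
    & forall t, observed k S t = setT -> ppt k G <= t].
Proof.
rewrite /ppt; case: ex_minnP => m /boolp.asboolP[S [minS <-]] _.
exists S; rewrite /ppt_of; case: ex_minnP => l /eqP obs_l min_l.
by split=> // t /eqP; apply: min_l.
Qed.

Lemma power_dominating_card_gt0 S :
  0 < #|G| -> power_dominating k S -> 0 < #|S|.
Proof.
move=> G_gt0 [l /eqP obs_l]; rewrite card_gt0; apply: contraTneq G_gt0 => S0.
by rewrite -cardsT -obs_l S0 observed_set0 cards0.
Qed.

Lemma minimum_set1 v w l : minimum_power_dominating k [set v] ->
  observed k [set w] l = setT -> minimum_power_dominating k [set w].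
Proof.
move=> [_ minv] obs_l; split; first by exists l; apply/eqP.
by move=> S' /minv; rewrite !cards1.
Qed.

Lemma ppt_max_complete : (ppt k G).+1 = #|G| ->
  isomorphic G (complete 1) \/ isomorphic G (complete 2).
Proof.
have [S [minS obs_l min_l]] := ppt_attained; set l := ppt k G in obs_l min_l *.
move=> cardG; have G_gt0 : 0 < #|G| by rewrite -cardG.
have := observed_growth obs_l min_l; rewrite -cardG => growth.
have /cards1P[v Sv] : #|S| == 1.
  have := growth 0 isT; have := power_dominating_card_gt0 G_gt0 (proj1 minS).
  by rewrite /=; lia.
move: minS obs_l min_l growth; rewrite {S}Sv => minv obs_l min_l growth.
case l_eq: l => [|l'].
  left; apply: isomorphic_complete; first by rewrite -cardG l_eq.
  move: obs_l; rewrite l_eq /= => vT x y.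
  have /set1P-> : x \in [set v] by rewrite vT.
  have /set1P-> : y \in [set v] by rewrite vT.
  by rewrite adj_irr eqxx.
have v_nbr : v \notin nbr v by rewrite in_nbr adj_irr.
have nbr_v_neq0 : nbr v != set0.
  apply/eqP => nbr0.
  have stab : observed k [set v] 1 = observed k [set v] 0.
    by rewrite /= closed_nbr1 nbr0 setU0.
  have := min_l _ (etrans (esym (observed_stable stab (leq0n l))) obs_l).
  by rewrite l_eq.
have /cards1P[w nbr_v] : #|nbr v| == 1.
  rewrite eqn_leq card_gt0 nbr_v_neq0 andbT.
  have := growth 1; rewrite /= closed_nbr1 cardsU1 v_nbr l_eq => /(_ isT).
  by lia.
case: l' l_eq => [|l'] l_eq.
  right; apply: isomorphic_complete; first by rewrite -cardG l_eq.
  move: obs_l; rewrite l_eq /= closed_nbr1 nbr_v => vwT.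
  have adj_vw : adj v w by rewrite -in_nbr nbr_v set11.
  have vDw : v != w by apply: contraTneq adj_vw => <-; rewrite adj_irr.
  move=> x y; have: x \in [set v; w] by rewrite vwT.
  have: y \in [set v; w] by rewrite vwT.
  case/set2P=> -> /set2P[]->; rewrite ?adj_irr ?eqxx ?vDw //.
  by rewrite adj_sym adj_vw eq_sym vDw.
have second_round : observed k [set v] 2 != observed k [set v] 1.
  apply/eqP => stab; have l_ge1 : 1 <= l by rewrite l_eq.
  have := min_l _ (etrans (esym (observed_stable stab l_ge1)) obs_l).
  by rewrite l_eq.
have obs_w : observed k [set w] l'.+1 = setT.
  by rewrite (observed_leaf_shift nbr_v second_round) -l_eq.
by have := ppt_le (minimum_set1 minv obs_w) obs_w; rewrite -/l l_eq ltnn.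
Qed.

Lemma ppt_card1 : #|G| = 1 -> ppt k G = 0.
Proof.
move=> cardG; have [S [[pdS _] _ min_l]] := ppt_attained.
have S_gt0 : 0 < #|S| by apply: power_dominating_card_gt0; rewrite ?cardG.
apply/eqP; rewrite -leqn0; apply: min_l; apply/eqP.
by rewrite /= eqEcard subsetT cardsT cardG.
Qed.

Lemma ppt_complete2 : #|G| = 2 -> (forall x y : G, adj x y = (x != y)) ->
  ppt k G = 1.
Proof.
move=> cardG adjE; have [S [[pdS minS] obs_l min_l]] := ppt_attained.
have obs1 v : observed k [set v] 1 = setT.
  rewrite /= closed_nbr1; apply/setP=> x.
  by rewrite in_setU1 in_nbr adjE in_setT eq_sym orbN.
have S_gt0 : 0 < #|S| by apply: power_dominating_card_gt0; rewrite ?cardG.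
have /card_gt0P[v vS] := S_gt0.
have S_le1 : #|S| <= 1.
  by rewrite -(cards1 v); apply: minS; exists 1; rewrite obs1.
have Sv : S = [set v].
  by apply/esym/eqP; rewrite eqEcard sub1set vS cards1.
apply/eqP; rewrite eqn_leq min_l ?Sv ?obs1 //=.
rewrite lt0n; apply: contraTneq S_le1 => ppt0.
by move: obs_l; rewrite ppt0 /= => ->; rewrite cardsT cardG.
Qed.

End Propagation.

Theorem theorem31 (G : sgraph) (n : nat) (hn : #|G| = n) (k : nat) (hk : 1 <= k) :
  ((ppt k G)%:Z = n%:Z - 1)%R <->
  isomorphic G (complete 1) \/ isomorphic G (complete 2).
Proof.
split=> [ppt_n | [] /complete_isomorphic[cardG adjE]].
- by apply: (@ppt_max_complete k); rewrite hn; lia.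
- by rewrite -hn cardG ppt_card1.
- by rewrite -hn cardG ppt_complete2.
Qed.
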